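(* Let $q$ be a prime power and suppose there is a $q$-ary Singleton-optimal $[n,k,d;r]$-locally repairable code with $d=7$, $r<k$ and $n\ge2(r+1)$. Then (with absolute implied constants): (i) $n=O(1)$ if $r=1$; (ii) $n=O(q)$ if $r=2$ and the Main MDS Conjecture holds; (iii) $n=O(q)$ if $r=3$, $k\equiv0\pmod3$ and the Main MDS Conjecture holds; and $n=O(q^2)$ if $r=3$ and $k\not\equiv0\pmod3$; (iv) $n=O(q^2)$ if $r=4$ or $5$; (v) $n=O(r)$ if $r\ge6$ and $k\equiv0,-1,-2,-3$ or $-4\pmod r$; (vi) $n=O\big(q^{\frac{4r-2}{r+1}}\big)$ if $r\ge6$ and $r=o(n)$ (i.e. along any sequence of such codes, with $q,n,k,r$ possibly varying, for which $r/n\to0$).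
   Context: An $[n,k,d;r]$-locally repairable code over $\mathbb{F}_q$ is a linear code $\mathcal{C}\subseteq\mathbb{F}_q^n$ of dimension $k$ and minimum Hamming distance $d$ with locality $r$ ($r\ge1$): for every $i\in[n]=\{1,\dots,n\}$ there is $I_i\subseteq[n]\setminus\{i\}$ with $|I_i|\le r$ such that any two codewords agreeing on $I_i$ also agree at $i$. For linear codes this is equivalent to: for every $i\in[n]$ there is $\mathbf{c}\in\mathcal{C}^\perp$ with $i\in\mathrm{supp}(\mathbf{c})$ and $|\mathrm{supp}(\mathbf{c})|\le r+1$. Such a code always satisfies $d\le n-k-\lceil k/r\rceil+2$ (Singleton-type bound) and is called Singleton-optimal if equality holds. Main MDS Conjecture: an $[n,k]$ linear code over $\mathbb{F}_q$ is MDS if its minimum distance is $n-k+1$, and nontrivial if $k\notin\{0,1,n-1,n\}$; the conjecture asserts that every nontrivial $[n,k]$ MDS code over $\mathbb{F}_q$ has $n\le q+2$ if $q$ is even and $k=3$ or $k=q-1$, and $n\le q+1$ otherwise. *)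

(* Defs.v *)
From HB Require Import structures.
From mathcomp Require Import all_boot all_order all_algebra.
From mathcomp Require Import classical_sets reals topology normedtype sequences exp.

Set Implicit Arguments.
Unset Strict Implicit.
Unset Printing Implicit Defensive.

(* A linear code of length n over F is a subspace of the row space F^n. *)
Section LinearCodes.

Variables (F : finFieldType) (n : nat).
Implicit Types (C : {vspace 'rV[F]_n}) (x y : 'rV[F]_n) (k d r : nat).

Definition hamming_dist x y : nat := #|[set i | x 0%R i != y 0%R i]|.

(* Relational, so that the zero code has no minimum distance. *)
Definition is_min_dist C d : Prop :=
  (exists x y, [/\ x \in C, y \in C, x != y & hamming_dist x y = d]) /\
  {in C &, forall x y, x != y -> d <= hamming_dist x y}.

Definition has_locality C r : Prop :=
  forall i : 'I_n, exists I : {set 'I_n},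
    [/\ i \notin I, #|I| <= r
      & {in C &, forall x y,
           (forall j, j \in I -> x 0%R j = y 0%R j) -> x 0%R i = y 0%R i}].

(* An upper bound on the sizes of the recovering sets: r need not be the least
   locality parameter. *)
Definition is_lrc C k d r : Prop :=
  [/\ \dim C = k, is_min_dist C d, 0 < r & has_locality C r].

Definition ceil_div k r : nat := (k + r.-1) %/ r.

(* d = n - k - ceil (k / r) + 2, without truncated subtraction. *)
Definition singleton_optimal C k d r : Prop :=
  is_lrc C k d r /\ d + k + ceil_div k r = n + 2.

Definition is_mds C : Prop := is_min_dist C (n - \dim C + 1).

End LinearCodes.

Definition main_mds_conjecture : Prop :=
  forall (F : finFieldType) (n k : nat) (C : {vspace 'rV[F]_n}),
    let q := #|F| in
    \dim C = k -> is_mds C -> k \notin [:: 0; 1; n - 1; n] ->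
    n <= (if ~~ odd q && ((k == 3) || (k == q - 1)) then q + 2 else q + 1).

Definition exists_optimal_lrc (q n k d r : nat) : Prop :=
  exists (F : finFieldType) (C : {vspace 'rV[F]_n}),
    #|F| = q /\ singleton_optimal C k d r.

Definition admissible (q n k r : nat) : Prop :=
  [/\ exists_optimal_lrc q n k 7 r, r < k & 2 * (r + 1) <= n].

(* Main.v *)
(** Let [l = ceil (k / r)] and [j = l r - k < r]; optimality says [n = k + l + 5].
    Any [l] independent local parity checks have supports with union of size at
    least [k + l], that is, of deficiency at most [j] with respect to
    [l (r + 1)]: otherwise some two codewords agree on [n - 6] coordinates.
    A deficiency [j + 1] of a larger family of checks is already witnessed by
    [2 (j + 1)] of them, so when [j <= 4] and [l >= 10] a covering family of [m]
    checks satisfies [n <= m (r + 1) <= n + j].  As [n + j = l (r + 1) + 5], this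
    is impossible for [r = 1, 2], for [r = 3] with [3 | k], for [r = 5], and for
    [r >= 6], and forces [m = l + 1] otherwise.
    In the remaining cases, most coordinates lie in the support of one check only.
    The words satisfying [m] of the checks split into at most [q^(n - k - m)] cosets
    of the code, and about [n q^2] of them have weight at most 3; the latter lie in
    distinct cosets since the distance is 7.  This gives [n = O(q^2)] for
    [m = l + 1] and [n = O(q^3)] for [m = l], and [3 <= (4 r - 2) / (r + 1)]. *)

Require Import Defs.
From mathcomp Require Import all_boot all_order all_algebra all_field.
From mathcomp Require Import zify lra.
Import Order.TTheory GRing.Theory Num.Theory.

(** * Families of subsets of a finite set: peelable covers and deficiency *)

Section Covers.

Variables (T : finType) (G : T -> {set T}).
Implicit Types (A B P : {set T}).

Definition cover_of A : {set T} := \bigcup_(i in A) G i.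

Definition private A i : {set T} := G i :\: cover_of (A :\ i).

(* Order-free form of triangularity: it passes to subsets, and says that the
   checks with supports [G p] determine the coordinates in [P] one by one. *)
Definition peelable P : Prop :=
  forall A, A \subset P -> A != set0 -> exists2 p, p \in A & G p :&: A = [set p].

Lemma sub_cover A i : i \in A -> G i \subset cover_of A.
Proof. by move=> iA; apply: bigcup_sup. Qed.

Lemma peelable_sub A B : A \subset B -> peelable B -> peelable A.
Proof. by move=> sAB pB D sDA; apply: pB; apply: subset_trans sAB. Qed.

(** Greedy choice: while some [i] is uncovered, add it to [P]. No support chosen before contains
    [i], so an element that peels [A :\ i] also peels [A]. *)
Lemma exists_peelable_cover :
  (forall i, i \in G i) -> exists2 P, peelable P & cover_of P = [set: T].
Proof.
move=> Gi.
have [m] := ubnP (#|T| - #|@set0 T|).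
have : peelable set0 by move=> A; rewrite subset0 => ->.
elim: m set0 => // m IHm P pP leP.
have [|] := boolP (cover_of P == setT); first by move/eqP; exists P.
rewrite -subTset => /subsetPn[i _ iP].
have niP : i \notin P.
  by apply: contra iP => iP; apply: (subsetP (sub_cover P i iP)).
apply: (IHm (i |: P)); last first.
  by rewrite cardsU1 niP; have := max_card (mem (i |: P)); rewrite cardsU1 niP; lia.
move=> A sA A0.
have [Ai0|Ai0] := eqVneq (A :\ i) set0.
  have Ai : A = [set i].
    apply/eqP; rewrite eqEsubset sub1set; apply/andP; split.
      by rewrite -setD_eq0 Ai0.
    case/set0Pn: A0 => x xA; suff -> : i = x by [].
    apply/eqP; apply: contraTT isT => nix.
    by move/setP/(_ x): Ai0; rewrite !inE xA eq_sym nix.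
  by exists i; rewrite Ai ?inE //; apply/setIidPr; rewrite sub1set.
have sAP : A :\ i \subset P by rewrite subDset.
have [p pA Gp] := pP _ sAP Ai0.
have pPP := subsetP sAP _ pA.
exists p; first by case/setD1P: pA.
have iGp : i \notin G p by apply: contra iP; apply/subsetP/sub_cover.
rewrite -Gp; apply/setP=> x; rewrite !inE.
by case: (eqVneq x i) => //= ->; rewrite (negbTE iGp).
Qed.

Lemma private_disjoint A i j x :
  i \in A -> x \in private A i -> x \in private A j -> i = j.
Proof.
move=> iA /setDP[xi _] /setDP[_ xj]; apply/eqP; apply: contraNT xj => nij.
by apply: subsetP (sub_cover _ i _) x xi; rewrite !inE nij.
Qed.

Lemma card_coverD1 A i :
  i \in A -> #|cover_of A| = #|private A i| + #|cover_of (A :\ i)|.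
Proof.
move=> iA; rewrite /private -(cardsID (cover_of (A :\ i)) (cover_of A)) addnC.
have cE : cover_of A = G i :|: cover_of (A :\ i).
  by rewrite /cover_of (big_setD1 i iA).
congr (_ + _); apply: eq_card => x; rewrite cE !inE.
  by case: (x \in cover_of (A :\ i)) => //=; rewrite orbF.
by rewrite orbC andbC; case: (x \in cover_of (A :\ i)).
Qed.

(** Double counting: a covered point counts once in each sum if it lies in one support only, and at
    least twice in the second sum otherwise. *)
Lemma card_cover_private A :
  2 * #|cover_of A| <= \sum_(i in A) #|private A i| + \sum_(i in A) #|G i|.
Proof.
have cardE (H : T -> {set T}) :
    \sum_(i in A) #|H i| = \sum_x \sum_(i in A) (x \in H i).
  rewrite exchange_big; apply: eq_bigr => i _.
  by rewrite -sum1_card big_mkcond; apply: eq_bigr => x _; case: (x \in H i).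
rewrite !cardE -big_split /= -sum1_card big_distrr /= big_mkcond /=.
apply: leq_sum => x _; case: ifP => // /bigcupP[i iA xi].
rewrite muln1 (bigD1 i iA) /= [X in _ + X](bigD1 i iA) /= xi.
have [xc|xc] := boolP (x \in cover_of (A :\ i)).
  case/bigcupP: xc => j /setD1P[nji jA] xj.
  by rewrite [X in _ + (_ + X)](bigD1 j) /= ?xj; [lia | exact/andP].
by rewrite in_setD xc xi; lia.
Qed.

(* The deficiency [D = b * |B| - |cover_of B|] drops by [b - |private B i|] when
   [i] is removed, and these drops sum to at most [2 D]; so, while
   [|B| > 2 (j + 1)], some removal keeps the deficiency above [j]. *)
Lemma deficient_subset B b j l :
  (forall i, i \in B -> #|G i| <= b) -> #|cover_of B| + j < #|B| * b ->
  2 * j.+1 <= l <= #|B| ->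
  exists A : {set T}, [/\ A \subset B, #|A| = l & #|cover_of A| + j < l * b].
Proof.
have [m] := ubnP (#|B| - l); elim: m B => // m IHm B leB Gb defB /andP[jl lB].
have [eqB|neqB] := eqVneq #|B| l; first by exists B; rewrite -eqB.
have [i iB defBi] :
    exists2 i, i \in B & #|cover_of (B :\ i)| + j < (#|B| - 1) * b.
  have [/exists_inP //|] := boolP
    [exists i in B, #|cover_of (B :\ i)| + j < (#|B| - 1) * b].
  rewrite negb_exists_in => /forall_inP drop.
  have B0 : 0 < #|B| by lia.
  (* [X] is the excess of the deficiency over [j]. If every removal fails, each private part has
     size at most [b - X], whence [#|B| * X <= 2 (X + j)]; but [#|B| > 2 (j + 1)]. *)
  set X := #|B| * b - #|cover_of B| - j.
  have drops : \sum_(i in B) #|private B i| + #|B| * X <= #|B| * b.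
    rewrite -!sum_nat_const -big_split /=; apply: leq_sum => i iB.
    have := drop i iB; rewrite -leqNgt mulnBl mul1n /X.
    by have := card_coverD1 _ _ iB; have := leq_pmull b B0; lia.
  have GB : \sum_(i in B) #|G i| <= #|B| * b.
    by rewrite -sum_nat_const; apply: leq_sum => i /Gb.
  have := card_cover_private B; have X0 : 0 < X by rewrite /X; lia.
  have : (2 * j.+1 + 1) * X <= #|B| * X by rewrite leq_mul2r; lia.
  by rewrite /X in drops X0 *; nia.
have cBi := cardsD1 i B; rewrite iB in cBi.
have [||||A [sA cA dA]] := IHm (B :\ i).
- by lia.
- by move=> p /setD1P[_ /Gb].
- by rewrite (_ : #|B :\ i| = #|B| - 1) //; lia.
- by lia.
by exists A; split=> //; apply: subset_trans sA (subsetDl _ _).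
Qed.

Lemma subset_between A B m :
  A \subset B -> #|A| <= m <= #|B| ->
  exists S : {set T}, [/\ A \subset S, S \subset B & #|S| = m].
Proof.
elim: m => [|m IHm] sAB /andP[Am mB].
  by exists A; split=> //; apply/eqP; rewrite -leqn0.
have [Am'|neAm] := eqVneq #|A| m.+1; first by exists A.
have [|S [sAS sSB cS]] := IHm sAB; first by lia.
have /subsetPn[x xB xS] : ~~ (B \subset S).
  by apply/negP => /subset_leq_card; lia.
exists (x |: S); split; last by rewrite cardsU1 xS cS.
  exact: subset_trans sAS (subsetUr _ _).
by rewrite subUset sub1set xB.
Qed.

End Covers.

Arguments cover_of {T}.
Arguments private {T}.
Arguments peelable {T}.

Lemma leq_card_into (T T' : finType) (f : T -> T') (D : {set T}) (E : {pred T'}) :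
  {in D &, injective f} -> {in D, forall x, f x \in E} -> #|D| <= #|E|.
Proof.
move=> inj_f fE; rewrite -(card_in_imset inj_f); apply/subset_leq_card/subsetP.
by move=> _ /imsetP[x xD ->]; apply: fE.
Qed.

(** * Parity checks, recovery and sphere packing in linear codes *)

Section Checks.

Variables (F : finFieldType) (n : nat).
Implicit Types (C : {vspace 'rV[F]_n}) (P A S : {set 'I_n}) (x y : 'rV[F]_n).
Local Open Scope ring_scope.

Definition dot x y : F := \sum_i x 0 i * y 0 i.

Definition supp x : {set 'I_n} := [set i | x 0 i != 0].

Definition dual_word C x : Prop := {in C, forall y, dot x y = 0}.

Lemma dotD x y (z : 'rV[F]_n) : dot x (y + z) = dot x y + dot x z.
Proof. by rewrite /dot -big_split; apply: eq_bigr => i _; rewrite mxE mulrDr. Qed.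

Lemma dotZ (a : F) x y : dot x (a *: y) = a * dot x y.
Proof.
by rewrite /dot big_distrr; apply: eq_bigr => i _; rewrite mxE mulrCA.
Qed.

Lemma dotB x y (z : 'rV[F]_n) : dot x (y - z) = dot x y - dot x z.
Proof. by rewrite dotD -scaleN1r dotZ mulN1r. Qed.

Lemma dot_delta x i : dot x (delta_mx 0 i) = x 0 i.
Proof.
rewrite /dot (bigD1 i) //= mxE !eqxx mulr1 big1 ?addr0 // => j nji.
by rewrite mxE eqxx (negbTE nji) mulr0.
Qed.

(* A coordinate functional of [C] that vanishes wherever those in [I] do is a
   combination of them; the coefficients give the dual word. *)
Lemma local_dual_word C (I : {set 'I_n}) (i : 'I_n) :
  i \notin I ->
  {in C &, forall x y, (forall j, j \in I -> x 0 j = y 0 j) -> x 0 i = y 0 i} ->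
  exists c, [/\ i \in supp c, supp c \subset i |: I & dual_word C c].
Proof.
move=> iI recC; pose M := \matrix_(s < \dim C) (vbasis C)`_s.
have CM x : x \in C -> exists w : 'rV_(\dim C), x = w *m M.
  move=> xC; exists (\row_s coord (vbasis C) s x).
  rewrite {1}(coord_vbasis xC) mulmx_sum_row; apply: eq_bigr => s _.
  by rewrite mxE rowK.
have MC (w : 'rV_(\dim C)) : w *m M \in C.
  rewrite mulmx_sum_row; apply: memv_suml => s _; rewrite rowK memvZ //.
  by rewrite vbasis_mem // mem_nth // size_tuple.
pose B := \matrix_(j < n) if j \in I then row j M^T else 0.
have /submxP[w wE] : (row i M^T <= B)%MS.
  rewrite submxE; apply/eqP/rowP => s.
  (* The column [v] of the cokernel gives a codeword [v^T *m M] that vanishes on [I], hence at [i]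
     by recovery against the zero word. *)
  pose v := col s (cokermx B).
  have vM j : (v^T *m M) 0 j = (row j M^T *m cokermx B) 0 s.
    by rewrite !mxE; apply: eq_bigr => t _; rewrite !mxE mulrC.
  rewrite -vM [RHS]mxE.
  have -> : 0 = (0 : 'rV[F]_n) 0 i by rewrite mxE.
  apply: recC; rewrite ?MC ?mem0v // => j jI; rewrite vM [RHS]mxE.
  have -> : row j M^T = row j B by rewrite rowK jI.
  by rewrite -row_mul mulmx_coker row0 mxE.
pose c := \row_j ((j == i)%:R - (j \in I)%:R * w 0 j).
exists c; split.
- by rewrite inE mxE eqxx (negbTE iI) mul0r subr0 oner_eq0.
- apply/subsetP => j; rewrite !inE mxE; apply: contraNT; rewrite negb_or.
  by case/andP => /negbTE-> /negbTE->; rewrite mul0r subr0.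
move=> x /CM[u ->].
have wM t : M t i = \sum_j (j \in I)%:R * w 0 j * M t j.
  have := congr1 (fun A : 'rV_ _ => A 0 t) wE; rewrite !mxE => ->.
  apply: eq_bigr => j _; rewrite !mxE.
  by case: (j \in I); rewrite ?mxE ?mul1r // !(mul0r, mulr0).
rewrite mulmx_sum_row (_ : dot c _ = \sum_s u 0 s * dot c (row s M)); last first.
  elim/big_rec2: _ => [|s a b _ <-]; last by rewrite dotD dotZ.
  by rewrite /dot big1 // => j _; rewrite [X in _ * X]mxE mulr0.
rewrite big1 // => t _; rewrite (_ : dot c _ = 0) ?mulr0 //.
rewrite /dot; under eq_bigr => j _ do rewrite [c 0 _]mxE [row _ _ _ _]mxE mulrBl.
rewrite sumrB (bigD1 i) //= eqxx mul1r big1 ?addr0; last first.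
  by move=> j /negbTE->; rewrite mul0r.
by rewrite wM subrr.
Qed.

(** Peelability, applied to the positions of [P] where [x] is nonzero, yields a check that meets
    them in a single position; that check forces [x] to vanish there. *)
Lemma peelable_recover (c : 'I_n -> 'rV[F]_n) P x :
  (forall i, i \in supp (c i)) -> peelable (supp \o c) P ->
  {in P, forall p, dot (c p) x = 0} ->
  {in cover_of (supp \o c) P :\: P, forall i, x 0 i = 0} ->
  {in P, forall p, x 0 p = 0}.
Proof.
move=> cc pP chk x0 p pP'; apply/eqP; apply: contraT => xp.
pose A := [set i in P | x 0 i != 0].
have [||s sA Gs] := pP A.
- by apply/subsetP => i; rewrite inE => /andP[].
- by apply/set0Pn; exists p; rewrite inE pP'.
move: (sA); rewrite inE => /andP[sP xs].
have := chk s sP; rewrite /dot (bigD1 s) //= big1 ?addr0 => [|i nis].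
  by move/eqP; rewrite mulf_eq0 (negbTE xs) orbF; have := cc s; rewrite inE => /negbTE->.
have [->|ci] := eqVneq (c s 0 i) 0; first by rewrite mul0r.
have [->|xi] := eqVneq (x 0 i) 0; first by rewrite mulr0.
have iG : i \in supp (c s) by rewrite inE.
have [iP|iP] := boolP (i \in P).
  by move/setP/(_ i): Gs; rewrite in_setI /= iG !inE iP xi (negbTE nis).
case/eqP: xi; apply: x0; rewrite in_setD iP.
exact: subsetP (sub_cover _ (supp \o c) P s sP) i iG.
Qed.

Lemma hamming_dist_supp x y (S : {set 'I_n}) :
  {in ~: S, forall i, x 0 i = y 0 i} -> (hamming_dist x y <= #|S|)%N.
Proof.
move=> xy; apply/subset_leq_card/subsetP => i; rewrite inE.
by apply: contraR => iS; rewrite xy // inE.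
Qed.

Lemma card_vanishing_ffun P : #|pffun_on (0 : F) (~: P) predT| = (#|F| ^ (n - #|P|))%N.
Proof. by rewrite card_pffun_on cardsCs setCK card_ord. Qed.

Lemma card_code C : #|[set x in C]| = (#|F| ^ \dim C)%N.
Proof. by rewrite cardsE card_vspace. Qed.

(** Otherwise the union of the supports extends to a set [S] of [\dim C + #|A| - 1] positions. By
    pigeonhole two codewords agree on [S :\: A], which has [\dim C - 1] positions; the checks extend
    the agreement to [S], whose complement has fewer than [d] positions. *)
Lemma card_cover_lower C (c : 'I_n -> 'rV[F]_n) A d :
  (forall i, i \in supp (c i)) -> (forall i, dual_word C (c i)) ->
  peelable (supp \o c) A -> is_min_dist C d ->
  (\dim C + #|A| <= n < \dim C + #|A| + d - 1)%N ->
  (\dim C + #|A| <= #|cover_of (supp \o c) A|)%N.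
Proof.
move=> cc cC pA [_ minC] /andP[leqn ltn]; rewrite leqNgt; apply/negP => ltU.
have sAU : A \subset cover_of (supp \o c) A.
  apply/subsetP => i iA.
  exact: subsetP (sub_cover _ (supp \o c) A i iA) i (cc i).
have [||S [sUS _ cS]] :=
  subset_between _ (cover_of (supp \o c) A) setT (\dim C + #|A| - 1).
- exact: subsetT.
- by rewrite cardsT card_ord; lia.
have sAS := subset_trans sAU sUS.
pose f x := [ffun i => if i \in S :\: A then x 0 i else 0].
have /dinjectivePn[x xC [y]] : ~~ dinjectiveb f (mem C).
  apply/negP => /dinjectiveP inj_f.
  have fE : {in [set x in C], forall x, f x \in pffun_on (0 : F) (S :\: A) predT}.
    move=> x _; apply/pffun_onP; split=> //; apply/subsetP => i.
    by rewrite inE ffunE; case: ifP => //; rewrite eqxx.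
  have inj_f' : {in [set x in C] &, injective f}.
    by move=> x y; rewrite !inE; apply: inj_f.
  have := leq_card_into _ _ f _ _ inj_f' fE.
  rewrite card_code card_pffun_on cardsD (setIidPr sAS) cS leq_exp2l.
    have cAU : (#|A| <= #|cover_of (supp \o c) A|)%N := subset_leq_card sAU.
    by move: cAU ltU; set a := #|A|; set e := #|cover_of _ A|; lia.
  exact: finNzRing_gt1.
case/andP => nyx yC fxy.
have xyS : {in S, forall i, x 0 i = y 0 i}.
  have xySA i : i \in S :\: A -> x 0 i = y 0 i.
    by move=> iSA; have := congr1 (fun g : {ffun _} => g i) fxy; rewrite !ffunE iSA.
  move=> i iS; have [iA|iA] := boolP (i \in A); last by apply: xySA; rewrite in_setD iA.
  have := peelable_recover c A (x - y) cc pA _ _ i iA.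
  rewrite !mxE => xy0; apply/eqP; rewrite -subr_eq0; apply/eqP/xy0.
    by move=> p _; apply: cC; rewrite memvB.
  move=> j /setDP[jU jA]; rewrite !mxE xySA ?subrr //.
  by rewrite in_setD jA (subsetP sUS).
have := minC x y xC yC; rewrite eq_sym nyx => /(_ isT).
have := hamming_dist_supp x y (~: S).
rewrite setCK => /(_ xyS); rewrite cardsCs setCK card_ord cS; lia.
Qed.

(* Sphere packing among the words satisfying the checks in [P]: these include the
   words of weight at most 3 supported on [x] and the two anchors [a p], [b p] of
   its block, and such words lie in distinct cosets of [C]. *)
Lemma sphere_packing C (c : 'I_n -> 'rV[F]_n) P (a b : 'I_n -> 'I_n)
    (Y : 'I_n -> {set 'I_n}) :
  let priv := private (supp \o c) P in
  (forall i, i \in supp (c i)) -> (forall i, dual_word C (c i)) ->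
  peelable (supp \o c) P ->
  {in C &, forall x y, x != y -> (7 <= hamming_dist x y)%N} ->
  {in P, forall p, [/\ Y p \subset priv p :\: [set a p; b p]
     & Y p != set0 -> [/\ a p \in priv p, b p \in priv p & a p != b p]]} ->
  ((\sum_(p in P) #|Y p|) * ((#|F| - 1) * #|F|) * #|F| ^ \dim C <= #|F| ^ (n - #|P|))%N.
Proof.
move=> priv cc cC pP minC YP.
pose Y2 := [set z : 'I_n * 'I_n | (z.1 \in P) && (z.2 \in Y z.1)].
have cY2 : #|Y2| = (\sum_(p in P) #|Y p|)%N.
  rewrite -sum1dep_card -(pair_big_dep (mem P) (fun p i => i \in Y p) (fun _ _ => 1%N)).
  by apply: eq_bigr => p _; rewrite sum1_card.
(* The coefficient at [b p] is solved from check [p]; the other checks of [P] vanish at private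
   positions of [p]. *)
pose w p i v u := - (c p 0 i * v + c p 0 (a p) * u) / c p 0 (b p).
pose e (z : 'I_n * 'I_n) (v u : F) : 'rV[F]_n :=
  v *: delta_mx 0 z.2 + (u *: delta_mx 0 (a z.1) + w z.1 z.2 v u *: delta_mx 0 (b z.1)).
have eE z v u i : e z v u 0 i =
    v * (i == z.2)%:R + (u * (i == a z.1)%:R + w z.1 z.2 v u * (i == b z.1)%:R).
  by rewrite !mxE eqxx.
have Y2P z : z \in Y2 -> [/\ z.1 \in P, z.2 \in priv z.1, a z.1 \in priv z.1,
    b z.1 \in priv z.1 & [/\ a z.1 != b z.1, z.2 != a z.1 & z.2 != b z.1]].
  rewrite inE => /andP[zP zY]; have [sY Y0] := YP _ zP.
  have [|aP bP ab] := Y0; first by apply/set0Pn; exists z.2.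
  move/(subsetP sY): zY; rewrite in_setD in_set2 negb_or => /andP[/andP[xa xb] xp].
  by split.
have priv0 p s i : s \in P -> i \in priv p -> s != p -> c s 0 i = 0.
  move=> sP /setDP[_ iU] nsp; apply/eqP; apply: contraNT iU => csi.
  by apply: (subsetP (sub_cover _ _ _ s _)); rewrite /= !inE ?nsp.
have e_chk z v u s : z \in Y2 -> s \in P -> dot (c s) (e z v u) = 0.
  move=> /Y2P[zP xp ap bp _] sP; rewrite !dotD !dotZ !dot_delta.
  have [->|nsz] := eqVneq s z.1; last by rewrite !(priv0 z.1) // !mulr0 !addr0.
  have cb : c z.1 0 (b z.1) != 0 by move/setDP: bp; rewrite /= inE => -[].
  by rewrite /w mulfVK // addrA [v * _]mulrC [u * _]mulrC subrr.
have e_supp z v u i : i \notin [set z.2; a z.1; b z.1] -> e z v u 0 i = 0.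
  rewrite eE !inE !negb_or => /andP[/andP[/negbTE-> /negbTE->] /negbTE->].
  by rewrite !mulr0 !addr0.
(* Erasing the coordinates in [P] loses nothing, since the checks recover them. *)
pose g (t : ('I_n * 'I_n) * (F * F) * 'rV[F]_n) :=
  [ffun i => if i \in P then 0 else (t.2 + e t.1.1 t.1.2.1 t.1.2.2) 0 i].
pose D := setX (setX Y2 (setX [set~ (0 : F)] [set: F])) [set x in C].
have gE : {in D, forall t, g t \in pffun_on (0 : F) (~: P) predT}.
  move=> t _; apply/pffun_onP; split=> //; apply/subsetP => i.
  by rewrite !inE ffunE; case: ifP => //; rewrite eqxx.
have g_inj : {in D &, injective g}.
  move=> [[z [v u]] y] [[z' [v' u']] y'].
  rewrite !in_setX !inE /= !andbT -/(e z v u) -/(e z' v' u').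
  move=> /andP[/andP[zY v0] yC] /andP[/andP[zY' v0'] yC'] gg.
  have zY2 : z \in Y2 by rewrite inE.
  have zY2' : z' \in Y2 by rewrite inE.
  pose d := (y + e z v u) - (y' + e z' v' u').
  have dP i : i \notin P -> d 0 i = 0.
    move=> iP; have := congr1 (fun h : {ffun _} => h i) gg.
    by rewrite !ffunE (negbTE iP) /= => eqi; rewrite /d mxE [X in _ + X]mxE eqi subrr.
  have d0 : d = 0.
    apply/rowP => i; rewrite [RHS]mxE; have [iP|] := boolP (i \in P); last exact: dP.
    apply: (peelable_recover c P) iP => // [s sP|j /setDP[_ jP]]; last exact: dP.
    by rewrite dotB (dotD _ y) (dotD _ y') !e_chk // (cC s y yC) (cC s y' yC') subrr.
  have yy' : y = y'.
    apply/eqP; apply: contraT => nyy'; have := minC y y' yC yC' nyy'.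
    rewrite ltnNge => /negP[].
    pose S := [set z.2; a z.1; b z.1] :|: [set z'.2; a z'.1; b z'.1].
    apply: (@leq_trans #|S|).
      apply: hamming_dist_supp => i; rewrite in_setC in_setU negb_or => /andP[i1 i2].
      have := congr1 (fun h : 'rV_ _ => h 0 i) d0.
      rewrite /d !mxE -[X in y 0 i + X](_ : e z v u 0 i = _); last by rewrite !mxE.
      rewrite -[X in y' 0 i + X](_ : e z' v' u' 0 i = _); last by rewrite !mxE.
      by rewrite !e_supp // !addr0 => /eqP; rewrite subr_eq0 => /eqP.
    apply: leq_trans (leq_card_setU _ _) _.
    have c3 (p q r : 'I_n) : (#|[set p; q; r]| <= 3)%N.
      by rewrite setUC cardsU1 cards2; case: (_ \notin _); case: (_ != _).
    exact: leq_add (c3 _ _ _) (c3 _ _ _).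
  have ee : e z v u = e z' v' u'.
    by apply/eqP; move/eqP: d0; rewrite /d -yy' opprD addrACA subrr add0r subr_eq0.
  have [zP xp ap bp [ab xa xb]] := Y2P _ zY2.
  have [zP' xp' ap' bp' [ab' xa' xb']] := Y2P _ zY2'.
  have ex : e z v u 0 z.2 = v.
    by rewrite eE eqxx (negbTE xa) (negbTE xb) !mulr0 !addr0 mulr1.
  (* As [v] is nonzero, [z.2] lies in the support of the second word; private parts are disjoint, so
     the blocks coincide, and [z.2] is not an anchor. *)
  have eqz : z = z'.
    have xe : z.2 \in [set z'.2; a z'.1; b z'.1].
      by apply: contraR v0 => /(e_supp z' v' u'); rewrite -ee ex => ->.
    have eqz1 : z.1 = z'.1.
      apply: (private_disjoint _ _ P _ _ z.2 zP xp).
      by case/setUP: xe => [/set2P[->|->]|/set1P->].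
    move: xe; rewrite !inE -eqz1 (negbTE xa) (negbTE xb) !orbF => /eqP eqz2.
    by rewrite [z]surjective_pairing [z']surjective_pairing eqz1 eqz2.
  have ea : e z v u 0 (a z.1) = u.
    by rewrite eE eqxx (negbTE ab) eq_sym (negbTE xa) !mulr0 addr0 add0r mulr1.
  have ex' : e z v' u' 0 z.2 = v'.
    by rewrite eE eqxx (negbTE xa) (negbTE xb) !mulr0 !addr0 mulr1.
  have ea' : e z v' u' 0 (a z.1) = u'.
    by rewrite eE eqxx (negbTE ab) eq_sym (negbTE xa) !mulr0 addr0 add0r mulr1.
  have vv' : v = v' by rewrite -ex ee -eqz ex'.
  have uu' : u = u' by rewrite -ea ee -eqz ea'.
  by rewrite yy' -eqz vv' uu'.
have := leq_card_into _ _ g _ _ g_inj gE.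
rewrite card_vanishing_ffun !cardsX card_code cY2 cardsT cardsC1 subn1; apply.
Qed.

(** If [A] has fewer than two elements, [t.2] is empty and the anchors are dummies. *)
Lemma exists_anchors (A : {set 'I_n}) (i0 : 'I_n) :
  exists t : 'I_n * 'I_n * {set 'I_n},
    [/\ t.2 \subset A :\: [set t.1.1; t.1.2], (#|A| <= #|t.2| + 2)%N
      & t.2 != set0 -> [/\ t.1.1 \in A, t.1.2 \in A & t.1.1 != t.1.2]].
Proof.
have [/card_gt1P[i [j [iA jA nij]]]|leA] := ltnP 1 #|A|; last first.
  by exists (i0, i0, set0); split; rewrite ?sub0set ?eqxx // cards0; lia.
exists (i, j, A :\: [set i; j]); split=> //=.
have := cardsID [set i; j] A; have := subset_leq_card (subsetIr A [set i; j]).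
rewrite cards2 nij /=; set s1 := #|A :&: _|; set s2 := #|A :\: _|; lia.
Qed.

(** By double counting, the private parts have total size at least twice the cover minus [#|P| * b];
    each block then loses two positions to its anchors. *)
Lemma packing_bound C (c : 'I_n -> 'rV[F]_n) P b :
  (forall i, i \in supp (c i)) -> (forall i, dual_word C (c i)) ->
  (forall i, #|supp (c i)| <= b)%N -> peelable (supp \o c) P ->
  {in C &, forall x y, x != y -> (7 <= hamming_dist x y)%N} ->
  ((2 * #|cover_of (supp \o c) P| - #|P| * (b + 2)) * ((#|F| - 1) * #|F|)
     * #|F| ^ \dim C <= #|F| ^ (n - #|P|))%N.
Proof.
move=> cc cC cb pP minC; pose priv := private (supp \o c) P.
have [t tP] := fin_all_exists (fun p => exists_anchors (priv p) p).
apply: leq_trans (sphere_packing C c P (fun p => (t p).1.1) (fun p => (t p).1.2)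
                   (fun p => (t p).2) cc cC pP minC _); last first.
  by move=> p _; have [] := tP p.
rewrite !leq_mul2r; apply/orP; right; apply/orP; right.
have Gb : (\sum_(i in P) #|(supp \o c) i| <= #|P| * b)%N.
  by rewrite -sum_nat_const; apply: leq_sum => i _; apply: cb.
have Yb : (\sum_(i in P) #|priv i| <= \sum_(i in P) #|(t i).2| + #|P| * 2)%N.
  by rewrite -sum_nat_const -big_split; apply: leq_sum => i _; have [] := tP i.
have := card_cover_private _ (supp \o c) P; rewrite -/priv.
move: Gb Yb; set s1 := (\sum_(i in P) #|(supp \o c) i|)%N.
set s2 := (\sum_(i in P) #|priv i|)%N; set s3 := (\sum_(i in P) _)%N; lia.
Qed.

End Checks.

Arguments supp {F n}.
Arguments dual_word {F n}.

(** * Parameter bounds for optimal codes *)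

Lemma ceil_divP k r : 0 < r -> k <= ceil_div k r * r < k + r.
Proof.
by move=> r0; rewrite /ceil_div; have := divn_eq (k + r.-1) r;
   have := ltn_pmod (k + r.-1) r0; lia.
Qed.

(** The factor 2 comes from [q <= 2 * (q - 1)]. *)
Lemma packing_factor q k e x :
  1 < q -> x * ((q - 1) * q) * q ^ k <= q ^ (k + (e + 2)) -> x <= 2 * q ^ e.
Proof.
move=> q1; have q0 := ltnW q1.
rewrite expnD mulnC leq_pmul2l ?expn_gt0 ?q0 // expnD -mulnn.
move: (q ^ e) => y pack.
have : x * (q - 1) <= y * q by rewrite -(leq_pmul2r q0) -!mulnA.
have : x * q <= x * (2 * (q - 1)) by rewrite leq_mul2l; lia.
rewrite -(leq_pmul2r q0); nia.
Qed.

(** The cubic bound packs with [l] checks of a peelable cover, where [n - l = k + 5]; the last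
    clause uses all [m] checks of the cover, and [n - m = k + 4] when [m = l + 1]. *)
Lemma optimal_lrc_bounds (F : finFieldType) n (C : {vspace 'rV[F]_n}) k r :
  singleton_optimal C k 7 r ->
  let l := ceil_div k r in let q := #|F| in
  [/\ 1 < q, n = k + l + 5, (l - 2) * (r - 1) <= 2 * q ^ 3
    & 10 <= l -> l * r <= k + 4 ->
      exists m, [/\ n <= m * (r + 1), m * (r + 1) <= l * (r + 1) + 5
        & m = l + 1 -> 2 * n - m * (r + 3) <= 2 * q ^ 2]].
Proof.
move=> [[dimC [[u [v uv]] minC] r0 locC] nE] l q.
have dmin : is_min_dist C 7 by split=> //; exists u, v.
have {}nE : n = k + l + 5 by rewrite /l; lia.
have /andP[kl lk] := ceil_divP k r r0; rewrite -/l in kl lk.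
have q1 : 1 < q by apply: finNzRing_gt1.
have local_word i : exists w : 'rV[F]_n,
    [/\ i \in supp w, #|supp w| <= r + 1 & dual_word C w].
  have [I [iI Ir recI]] := locC i.
  have [w [iw sw Cw]] := local_dual_word _ _ C I i iI recI.
  exists w; split=> //; apply: leq_trans (subset_leq_card sw) _.
  by rewrite cardsU1 iI; lia.
have [c cP] := fin_all_exists local_word.
have cc i : i \in supp (c i) by case: (cP i).
have cr i : #|supp (c i)| <= r + 1 by case: (cP i).
have cC i : dual_word C (c i) by case: (cP i).
have [P pP covP] := exists_peelable_cover _ (supp \o c) cc.
have cover_le (A : {set 'I_n}) :
    #|cover_of (supp \o c) A| <= #|A| * (r + 1).
  rewrite -sum_nat_const /cover_of.
  elim/(@big_rec2 {set 'I_n} nat): _ => [|i s B _ le]; first by rewrite cards0.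
  by apply: leq_trans (leq_card_setU _ _) (leq_add (cr i) le).
have cover_ge (A : {set 'I_n}) : A \subset P -> #|A| = l ->
    k + l <= #|cover_of (supp \o c) A|.
  move=> sAP cA; rewrite -cA -dimC; apply: card_cover_lower cc cC _ dmin _.
    exact: peelable_sub pP.
  by rewrite dimC cA; lia.
have cT : #|cover_of (supp \o c) P| = n by rewrite covP cardsT card_ord.
have nP : n <= #|P| * (r + 1) by rewrite -[X in X <= _]cT; apply: cover_le.
have lP : l <= #|P| by rewrite leqNgt; apply/negP => Pl; nia.
split=> //.
- have [||A [_ sAP cA]] := subset_between _ set0 P l.
  + exact: sub0set.
  + by rewrite cards0.
  have := packing_bound _ _ C c A (r + 1) cc cC cr (peelable_sub _ _ _ _ sAP pP) minC.
  rewrite dimC cA -/q => pack; have covA := cover_ge A sAP cA.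
  rewrite (_ : n - l = k + (3 + 2)) in pack; last by lia.
  apply: leq_trans (packing_factor _ _ _ _ q1 pack).
  move: covA; set s := #|_| => covA.
  have [l2|l2] := leqP l 2; first by rewrite (eqP l2).
  (* The right-hand side is at most [2 * s], because [l * r - r + 1 <= k] and [k + l <= s]. *)
  have : (l - 2) * (r - 1) + l * (r + 1 + 2) = 2 * (l * r + l + 1 - r) by nia.
  by lia.
- move=> l10 lk4; exists #|P|; split=> // [|Pl]; last first.
    have := packing_bound _ _ C c P (r + 1) cc cC cr pP minC.
    rewrite cT dimC -addnA (_ : n - _ = k + (2 + 2)); last by rewrite Pl; lia.
    exact: packing_factor.
  (* As [n + (l r - k) = l (r + 1) + 5], a larger family would have deficiency above [l r - k <= 4].
     Since [l >= 10], some [l] of its checks already show this and cover fewer than [k + l]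
     positions. *)
  rewrite leqNgt; apply/negP => ltP.
  have [|||A [sAP cA]] := deficient_subset _ (supp \o c) P (r + 1) (l * r - k) l.
  + by move=> i _; apply: cr.
  + by rewrite cT; nia.
  + by rewrite lP; lia.
  by have := cover_ge A sAP cA; nia.
Qed.

(** * Bounds on the length for each range of the locality *)

Lemma admissible_bounds q n k r :
  admissible q n k r ->
  let l := ceil_div k r in
  [/\ 1 < q, 0 < r, k <= l * r < k + r /\ n = k + l + 5,
      (l - 2) * (r - 1) <= 2 * q ^ 3
    & 10 <= l -> l * r <= k + 4 ->
      exists m, [/\ n <= m * (r + 1), m * (r + 1) <= l * (r + 1) + 5
        & m = l + 1 -> 2 * n - m * (r + 3) <= 2 * q ^ 2]].
Proof.
move=> [[F [C [<- opt]]] _ _] l; have [[_ _ r0 _] _] := opt.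
have [? ? ? ?] := optimal_lrc_bounds _ _ _ _ _ opt.
by split=> //; split=> //; apply: ceil_divP.
Qed.

(** For [l >= 10], no multiple of [r + 1] lies between [n] and [l (r + 1) + 5]: the offsets from
    [l (r + 1)] are 5 for [r = 1], 4 and 5 for [r = 2], and 5 for [r = 3]. *)
Lemma admissible_small_locality q n k r :
  admissible q n k r -> [\/ r = 1, r = 2 | r = 3 /\ k = 0 %[mod 3]] -> n <= 59.
Proof.
move=> /admissible_bounds[_ _ [kl nE] _ large] hr; move: kl nE large.
set l := ceil_div k r => kl nE large.
have [l10|l10] := ltnP l 10.
  by case: hr => [r1|r2|[r3 _]]; subst r; lia.
have [|m [nm ml _]] := large l10; first by case: hr => [r1|r2|[r3 _]]; subst r; lia.
by case: hr => [r1|r2|[r3 k3]]; subst r; lia.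
Qed.

(** For [l >= 10], only [m = l + 1] is possible if [r] is 3 or 4, and no [m] if [r = 5]. The
    constant [59 = 9 * 5 + 9 + 5] bounds [k + l + 5] when [l <= 9]. *)
Lemma admissible_quadratic q n k r :
  admissible q n k r -> 3 <= r <= 5 -> n <= 59 * q ^ 2.
Proof.
move=> /admissible_bounds[q1 _ [kl nE] _ large] hr; move: kl nE large.
set l := ceil_div k r => kl nE large.
have q20 : 0 < q ^ 2 by rewrite expn_gt0 ltnW.
have [l10|l10] := ltnP l 10; first by nia.
have [|m [nm ml sph]] := large l10; first by lia.
move: (q ^ 2) q20 sph => y y0 sph.
have : r = 3 \/ r = 4 \/ r = 5 by lia.
case=> [r3|[r4|r5]]; subst r; last by lia.
  by have ml1 : m = l + 1; [lia | have := sph ml1; lia].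
by have ml1 : m = l + 1; [lia | have := sph ml1; lia].
Qed.

(** For [l >= 10], a cover would have [m <= l] checks because [r + 1 > 5], whereas [l r <= k + 4]
    gives [n >= l (r + 1) + 1]. So [l <= 9]. *)
Lemma admissible_small_deficiency q n k r j :
  admissible q n k r -> 6 <= r -> j <= 4 -> k + j = 0 %[mod r] -> n <= 12 * r.
Proof.
move=> /admissible_bounds[_ _ [/andP[kl lk] nE] _ large] r6 j4 kj.
move: kl lk nE large; set l := ceil_div k r => kl lk nE large.
have lk4 : l * r <= k + 4.
  have /dvdnP[t kt] : r %| k + j by rewrite /dvdn kj mod0n.
  have : l * r < t.+1 * r by rewrite mulSn -kt; lia.
  rewrite ltn_mul2r => /andP[_ lt]; have := leq_mul lt (leqnn r); lia.
have [l10|l10] := ltnP l 10; first by have := leq_mul l10 (leqnn r.+1); nia.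
have [m [nm ml _]] := large l10 lk4.
have : m * (r + 1) < l.+1 * (r + 1) by rewrite mulSn; lia.
rewrite ltn_mul2r => /andP[_ mlt]; have := leq_mul mlt (leqnn (r + 1)); lia.
Qed.

(** [l <= 2] would give [n <= 2 r + 7]; for [l >= 3] the product [(l - 2) (r - 1)] has the order of
    [n]. *)
Lemma admissible_cubic q n k r :
  admissible q n k r -> 6 <= r -> 20 * r < n -> n <= 17 * q ^ 3.
Proof.
move=> /admissible_bounds[q1 _ [/andP[kl lk] nE] cub _] r6 rn.
move: kl lk nE cub; set l := ceil_div k r => kl lk nE cub.
have : 0 < q ^ 3 by rewrite expn_gt0 ltnW.
have l3 : 3 <= l by rewrite leqNgt; apply/negP => l3; nia.
by move: (q ^ 3) cub => y cub y0; nia.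
Qed.

(* Asymptotic form over the reals *)
From mathcomp Require Import classical_sets reals topology normedtype sequences exp.
Import numFieldNormedType.Exports.
Local Open Scope classical_set_scope.
Local Open Scope ring_scope.

Theorem theorem3p12 (R : realType) :
  (exists c : R, forall q n k r : nat, admissible q n k r ->
     r = 1%N -> n%:R <= c) /\
  (main_mds_conjecture ->
   exists c : R, forall q n k r : nat, admissible q n k r ->
     r = 2%N -> n%:R <= c * q%:R) /\
  (main_mds_conjecture ->
   exists c : R, forall q n k r : nat, admissible q n k r ->
     r = 3%N -> (k = 0 %[mod 3])%N -> n%:R <= c * q%:R) /\
  (exists c : R, forall q n k r : nat, admissible q n k r ->
     r = 3%N -> (k <> 0 %[mod 3])%N -> n%:R <= c * q%:R ^+ 2) /\
  (exists c : R, forall q n k r : nat, admissible q n k r ->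
     r = 4%N \/ r = 5%N -> n%:R <= c * q%:R ^+ 2) /\
  (exists c : R, forall q n k r : nat, admissible q n k r ->
     (6 <= r)%N ->
     (exists2 j : nat, (j <= 4)%N & (k + j = 0 %[mod r])%N) ->
     n%:R <= c * r%:R) /\
  (exists c : R, forall q n k r : nat -> nat,
     (forall m, admissible (q m) (n m) (k m) (r m) /\ (6 <= r m)%N) ->
     (fun m => (r m)%:R / (n m)%:R : R) @ \oo --> (0 : R) ->
     \forall m \near \oo,
       (n m)%:R <= c * (q m)%:R `^ ((4 * (r m)%:R - 2) / ((r m)%:R + 1))).
Proof.
have natle (a b c : nat) : (a <= b * c)%N -> a%:R <= b%:R * c%:R :> R.
  by rewrite -natrM ler_nat.
have qpos q n k r : admissible q n k r -> (0 < q)%N.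
  by case/admissible_bounds => /ltnW.
split.
  exists 59%:R => q n k r adm r1; rewrite ler_nat.
  by apply: (admissible_small_locality _ _ _ _ adm); constructor 1.
split=> [_|].
  exists 59%:R => q n k r adm r2; apply: natle.
  apply: leq_trans (leq_pmulr _ (qpos _ _ _ _ adm)).
  by apply: (admissible_small_locality _ _ _ _ adm); constructor 2.
split=> [_|].
  exists 59%:R => q n k r adm r3 k3; apply: natle.
  apply: leq_trans (leq_pmulr _ (qpos _ _ _ _ adm)).
  by apply: (admissible_small_locality _ _ _ _ adm); constructor 3.
split.
  exists 59%:R => q n k r adm r3 _; rewrite -natrX; apply: natle.
  by apply: (admissible_quadratic _ _ _ _ adm); rewrite r3.
split.
  exists 59%:R => q n k r adm r45; rewrite -natrX; apply: natle.
  by apply: (admissible_quadratic _ _ _ _ adm); case: r45 => ->.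
split.
  exists 12%:R => q n k r adm r6 [j j4 kj]; apply: natle.
  exact: admissible_small_deficiency adm r6 j4 kj.
exists 17%:R => q n k r adm rn0.
have /(cvgr0_norm_lt _ rn0) rn : 0 < 20%:R^-1 :> R by rewrite invr_gt0 ltr0n.
near=> m; have [admm r6] := adm m.
have n0 : 0 < (n m)%:R :> R.
  by rewrite ltr0n; case/admissible_bounds: admm => _ _ [_ ->] _ _; lia.
have rnm : (20 * r m < n m)%N.
  have : `|(r m)%:R / (n m)%:R : R| < 20%:R^-1 by near: m.
  rewrite ger0_norm ?divr_ge0 ?ler0n // ltr_pdivrMr // mulrC ltr_pdivlMr ?ltr0n //.
  by rewrite -natrM ltr_nat mulnC.
have q1 : 1 <= (q m)%:R :> R by rewrite ler1n (qpos _ _ _ _ admm).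
apply: (le_trans (natle _ _ _ (admissible_cubic _ _ _ _ admm r6 rnm))).
rewrite ler_wpM2l ?ler0n // natrX -powR_mulrn ?ler0n // ler_powR //.
(* The exponent is at least 3 exactly when [r >= 5]. *)
rewrite ler_pdivlMr ?ltr_wpDl ?ler0n //.
have r6' : 6%:R <= (r m)%:R :> R by rewrite ler_nat.
lra.
Unshelve. all: by end_near.
Qed.
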